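(* Let $i, n$ be positive integers such that $n > 4$ and $i \cdot 2^{n+2} + 1 = 2^{2^n - 4(n+2)} + i^4$. Then $2^{2^n - 4(n+2)} + i^4 \mid F_n$.
   Context: $F_n = 2^{2^n} + 1$ denotes the $n$-th Fermat number, for every $n \in \mathbb{N} = \{0,1,2,\dots\}$. *)

(* Defs.v *)
From mathcomp Require Import all_boot.

Definition fermat (n : nat) : nat := 2 ^ (2 ^ n) + 1.

(* Main.v *)
Require Import Defs.
From mathcomp Require Import all_boot.
From mathcomp Require Import zify ring.

(** Write [a = 2 ^ (n + 2)], [b = 2 ^ (2 ^ n - 4 * (n + 2))] and let
    [p = i * a + 1 = b + i ^ 4].  Modulo [p] we have [i * a = -1], hence
    [(i * a) ^ 4 = 1], while [i ^ 4 = - b]; so [b * a ^ 4 = -1], and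
    [b * a ^ 4 = 2 ^ (2 ^ n)]. *)

Lemma leq_mul4_exp2 (n : nat) : 4 < n -> 4 * (n + 2) <= 2 ^ n.
Proof.
(* The induction effectively starts at exponent 5, where the bound reads 28 <= 32; after that the
   left side grows by 4 while the right side doubles. *)
elim: n => // n IHn; rewrite ltnS leq_eqVlt => /predU1P [<- //|/IHn].
by rewrite expnS; lia.
Qed.

Lemma dvdn_mul_exp4_add1 (i a b : nat) :
  0 < i * a -> i * a + 1 = b + i ^ 4 -> b + i ^ 4 %| b * a ^ 4 + 1.
Proof.
move=> ia_gt0 def_p; set p := b + i ^ 4.
(* Naming the predecessor of [i * a] keeps truncated subtraction out of the identity left to
   [ring]. *)
have [y def_ia] : exists y, i * a = y.+1 by exists (i * a).-1; lia.
(* [x ^ 4 - 1 = (x + 1) * (x - 1) * (x ^ 2 + 1)] at [x = i * a = y + 1]. *)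
have E : b * a ^ 4 + 1 + p * (y * ((i * a) ^ 2 + 1)) = p * a ^ 4.
  (* Both forms of [p] serve: [b + i ^ 4] splits [p * a ^ 4] here, then [i * a + 1] is the factor
     [x + 1]. *)
  have -> : p * a ^ 4 = b * a ^ 4 + (i * a) ^ 4 by rewrite /p; ring.
  by rewrite /p -def_p def_ia; ring.
by rewrite -(dvdn_addl _ (dvdn_mulr (y * ((i * a) ^ 2 + 1)) (dvdnn p))) E dvdn_mulr.
Qed.

(* The truncated subtraction is exact: 4 * (n + 2) <= 2 ^ n as soon as 4 < n. *)
Theorem theorem2p18 (i n : nat) (hi : 0 < i) (hn : 4 < n)
    (h : i * 2 ^ (n + 2) + 1 = 2 ^ (2 ^ n - 4 * (n + 2)) + i ^ 4) :
  2 ^ (2 ^ n - 4 * (n + 2)) + i ^ 4 %| fermat n.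
Proof.
have -> : fermat n = 2 ^ (2 ^ n - 4 * (n + 2)) * (2 ^ (n + 2)) ^ 4 + 1.
  by rewrite -expnM -expnD [(n + 2) * 4]mulnC subnK // leq_mul4_exp2.
by apply: dvdn_mul_exp4_add1 => //; rewrite muln_gt0 hi expn_gt0.
Qed.
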